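(* Let $k$ be an algebraically closed field. If $Q\in k\langle x_1,\ldots,x_n\rangle$ is non-zero, then the codimension of $$M_{s,Q}:=\{\mathbf{r}\in M_s(k)^n\mid Q(\mathbf{r})=0\}$$ in $M_s(k)^n$ grows without bound (i.e. tends to infinity) as $s\to\infty$.
   Context: $k$ is an algebraically closed field of arbitrary characteristic. $k\langle x_1,\ldots,x_n\rangle$ is the free associative unital $k$-algebra; $M_s(k)$ is the algebra of $s\times s$ matrices, and $M_s(k)^n$ is regarded as an affine space of dimension $ns^2$. The codimension of an algebraic set $X$ in it is $ns^2-\dim X$, the empty set having infinite codimension. *)

(* Defs.v *)
From HB Require Import structures.
From mathcomp Require Import all_boot all_order all_algebra finmap.
From mathcomp Require Import all_classical all_reals all_analysis.
(* Importing their notations would clash with MathComp-Analysis. *)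
From mathcomp.multinomials Require monalg mpoly.
Export (canonicals, coercions) monalg mpoly.

Set Implicit Arguments.
Unset Strict Implicit.
Unset Printing Implicit Defensive.

Import Order.TTheory GRing.Theory Num.Theory.

Local Open Scope classical_set_scope.
Local Open Scope ring_scope.

(* The monoid algebra of the free monoid on 'I_n, i.e. k<x_1, ..., x_n>. *)
Notation free_algebra k n := (monalg.malg (monalg.fmonom 'I_n) k).

Section FreeAlgebraEval.
Variables (k : closedFieldType) (n s : nat).

(* monalg.mmap is not available here: its target must be a nontrivial ring,
   which 'M[k]_s is not known to be for a variable s. *)
Definition free_eval (Q : free_algebra k n) (r : {ffun 'I_n -> 'M[k]_s}) :
    'M[k]_s :=
  \sum_(w <- monalg.msupp Q)
    monalg.mcoeff w Q *: \prod_(i <- monalg.fmonom_val w) r i.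

Definition zero_locus (Q : free_algebra k n) : set {ffun 'I_n -> 'M[k]_s} :=
  [set r | free_eval Q r = 0].

End FreeAlgebraEval.

(* A finite-dimensional k-vector space V is seen as an affine space: polynomial
   functions on V are the polynomials in the coordinates on vbasis {:V}; as a
   change of basis is linear, the choice of this basis is immaterial. *)
Section AffineSpace.
Variables (k : closedFieldType) (V : vectType k).

Definition algebraic_set (Z : set V) : Prop :=
  exists S : set (mpoly.mpoly (\dim {:V}) k),
    Z = [set v | forall p, S p -> mpoly.meval (coord (vbasis {:V}) ^~ v) p = 0].

Definition irreducible_algebraic_set (Z : set V) : Prop :=
  [/\ algebraic_set Z, Z !=set0 &
      forall A B : set V, algebraic_set A -> algebraic_set B ->
        Z `<=` A `|` B -> Z `<=` A \/ Z `<=` B].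

(* Z 0 < Z 1 < ... < Z d : a chain of length d of irreducible closed subsets
   of X, where X is an algebraic set. *)
Definition irreducible_chain (X : set V) (d : nat) (Z : nat -> set V) : Prop :=
  (forall i, (i <= d)%N -> irreducible_algebraic_set (Z i) /\ Z i `<=` X) /\
  (forall i, (i < d)%N -> Z i `<` Z i.+1).

(* Krull dimension of an algebraic set for the Zariski topology, with values in
   the extended reals so that dim set0 = -oo. *)
Definition alg_dim (R : realType) (X : set V) : \bar R :=
  ereal_sup [set (d%:R)%:E | d in
               [set d : nat | exists Z, irreducible_chain X d Z]].

(* In particular the codimension of set0 is +oo. *)
Definition alg_codim (R : realType) (X : set V) : \bar R :=
  ((\dim {:V})%:R%:E - alg_dim R X)%E.

End AffineSpace.

Lemma dim_matrix_tuples (k : closedFieldType) (n s : nat) :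
  \dim {: {ffun 'I_n -> 'M[k]_s}} = (n * s ^ 2)%N.
Proof. by rewrite dimvf /dim /= card_ord. Qed.

Lemma alg_codim_set0 (k : closedFieldType) (V : vectType k) (R : realType) :
  alg_codim R (@set0 V) = +oo%E.
Proof.
rewrite /alg_codim /alg_dim (_ : [set d | _] = set0); last first.
  rewrite -subset0 => d [Z [/(_ 0%N isT)[[_ [v Zv] _] sub] _]].
  exact: sub Zv.
by rewrite image_set0 ereal_sup0.
Qed.

(* Main.v *)
Require Import Defs.
From mathcomp Require Import all_boot all_order all_algebra finmap.
From mathcomp Require Import all_classical all_reals all_analysis.
From mathcomp Require Import zify.

Set Implicit Arguments.
Unset Strict Implicit.
Unset Printing Implicit Defensive.

Import Order.TTheory GRing.Theory Num.Theory.
Local Open Scope classical_set_scope.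
Local Open Scope ring_scope.

(** Let d be the degree of Q and w0 a word of length d occurring in Q.  If d = 0
the zero locus is empty for s > 0; let d > 0.

For every N and s > N d there is an N-dimensional space L of tuples of matrices
on which the leading form of Q has no zero but 0.  On basis vectors numbered
from 0, draw arrows p -> p + 1 for p < N d, cut them into N blocks of d
successive arrows, and label the arrows of each block by the letters of w0.  The
tuple with parameter t in k^N gives the arrows of block b the weight t_b, and
its i-th matrix is the weighted adjacency matrix of the arrows labelled i.  The
only path of length d from the start to the end of block b spells w0, so the
corresponding entry of the leading form of Q is c t_b^d, where c is the
coefficient of w0 in Q (word_eval_path_point).

Take coordinates t_1, ..., t_N on L and M = n s^2 - N more on a complement of L.
At a zero of Q, the entry above expresses t_b^d through monomials of total degree
at most d and of degree less than d in t_1, ..., t_N (zero_locus_integral).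
Hence on the zero locus X every polynomial function of degree at most E is
a combination of monomials of degree at most E whose exponents in t_1, ..., t_N
are all less than d (spanned_reduced); there are at most d^N (E + 1)^M of these.
This is Noether normalization with bounded degrees: the coordinate ring of X is
finite over the polynomials in the M other coordinates.

Conversely, a chain Z_0 < ... < Z_D of irreducible closed subsets of X yields
polynomials f_1, ..., f_D, with f_i vanishing on Z_(i-1) but not on Z_i.  They
are algebraically independent on Z_D: in a relation, divide by the largest
possible power of f_D, which is allowed as Z_D is irreducible, and restrict to
Z_(D-1) (independent_on_powers).  So the (e + 1)^D monomials in the f_i with
exponents at most e are independent on X and of degree at most h e for a constant
h.  Then (e + 1)^D <= d^N (h e + 1)^M for all e, so D <= M, that is, the
codimension of X is at least N as soon as s > N d. *)

(** * Functions spanned by words in given functions *)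
Section WordSpans.
Context {k : fieldType} {T : Type} {J : eqType}.
Variables (X : set T) (y : J -> T -> k).
Implicit Types (P : pred (seq J)) (F G : T -> k) (w : seq J).

Definition monomial w (v : T) : k := \prod_(j <- w) y j v.

(** The space spanned, as functions on X, by the monomials of words in P.  Degree
bounds are conditions on words; the words are not commutative, so a product of
monomials is a mere concatenation. *)
Definition spanned P F : Prop :=
  exists2 l : seq (k * seq J), all (fun x => P x.2) l &
    forall v, X v -> F v = \sum_(x <- l) x.1 * monomial x.2 v.

Lemma eq_spanned P F G :
  (forall v, X v -> F v = G v) -> spanned P G -> spanned P F.
Proof. by move=> FG [l Pl Gl]; exists l => // v Xv; rewrite FG ?Gl. Qed.

Lemma sub_spanned P P' F : subpred P P' -> spanned P F -> spanned P' F.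
Proof.
by move=> PP' [l Pl Fl]; exists l => //; apply: sub_all Pl => x; exact: PP'.
Qed.

Lemma spanned_monomial P w : P w -> spanned P (monomial w).
Proof.
by move=> Pw; exists [:: (1, w)] => [|v _]; rewrite /= ?Pw // big_seq1 mul1r.
Qed.

Lemma spanned0 P : spanned P (fun=> 0).
Proof. by exists nil => // v _; rewrite big_nil. Qed.

Lemma spannedD P F G :
  spanned P F -> spanned P G -> spanned P (fun v => F v + G v).
Proof.
move=> [l Pl Fl] [m Pm Gm]; exists (l ++ m); first by rewrite all_cat Pl.
by move=> v Xv; rewrite big_cat Fl ?Gm.
Qed.

Lemma spannedZ P a F : spanned P F -> spanned P (fun v => a * F v).
Proof.
move=> [l Pl Fl]; exists [seq (a * x.1, x.2) | x <- l]; first by rewrite all_map.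
move=> v Xv; rewrite big_map Fl // big_distrr /=.
by apply: eq_bigr => x _; rewrite mulrA.
Qed.

Lemma spanned_sum (I : Type) (r : seq I) (C : pred I) P (F : I -> T -> k) :
  (forall i, C i -> spanned P (F i)) ->
  spanned P (fun v => \sum_(i <- r | C i) F i v).
Proof.
move=> PF; elim: r => [|i r IHr].
  by apply: eq_spanned (spanned0 P) => v _; rewrite big_nil.
have [Ci|nCi] := boolP (C i); last first.
  by apply: eq_spanned IHr => v _; rewrite big_cons (negPf nCi).
apply: eq_spanned (spannedD (PF _ Ci) IHr) => v _.
by rewrite big_cons Ci.
Qed.

Lemma spanned_trans P P' F :
  spanned P F -> (forall w, P w -> spanned P' (monomial w)) -> spanned P' F.
Proof.
move=> [l Pl Fl] PP'; apply: (eq_spanned Fl).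
elim: l Pl {Fl} => [_|x l IHl /= /andP[Px Pl]].
  by apply: eq_spanned (spanned0 P') => v _; rewrite big_nil.
apply: eq_spanned (spannedD (spannedZ x.1 (PP' _ Px)) (IHl Pl)) => v _.
by rewrite big_cons.
Qed.

Lemma spannedM {P P' P'' : pred (seq J)} {F G} :
  (forall u w, P u -> P' w -> P'' (u ++ w)) ->
  spanned P F -> spanned P' G -> spanned P'' (fun v => F v * G v).
Proof.
move=> PP [l Pl Fl] [m Pm Gm].
exists [seq (x.1 * z.1, x.2 ++ z.2) | x <- l, z <- m].
  by apply/allP => _ /allpairsP[[x z] [/(allP Pl) Px /(allP Pm) Pz ->]]; exact: PP.
move=> v Xv; rewrite Fl // Gm // big_allpairs_dep /= big_distrlr /=.
apply: eq_bigr => x _; apply: eq_bigr => z _.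
by rewrite /monomial big_cat /= mulrACA.
Qed.

Lemma spanned1 : spanned (fun u => size u <= 0)%N (fun=> 1).
Proof.
apply: eq_spanned (spanned_monomial (w := nil) _) => // v _.
by rewrite /monomial big_nil.
Qed.

Lemma spannedX h F e :
  spanned (fun u => size u <= h)%N F ->
  spanned (fun u => size u <= h * e)%N (fun v => F v ^+ e).
Proof.
move=> spF; elim: e => [|e IHe]; first by rewrite muln0; exact: spanned1.
apply: eq_spanned (spannedM _ spF IHe) => [v _|u w su sw]; first exact: exprS.
by rewrite size_cat mulnS leq_add.
Qed.

Lemma spanned_prod (I : Type) (r : seq I) (e : I -> nat) (F : I -> T -> k) :
  (forall i, spanned (fun u => size u <= e i)%N (F i)) ->
  spanned (fun u => size u <= \sum_(i <- r) e i)%N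
    (fun v => \prod_(i <- r) F i v).
Proof.
move=> spF; elim: r => [|i r IHr].
  by rewrite big_nil; apply: eq_spanned spanned1 => v _; rewrite big_nil.
apply: eq_spanned (spannedM _ (spF i) IHr) => [v _|u w su sw].
  by rewrite big_cons.
by rewrite size_cat big_cons leq_add.
Qed.

End WordSpans.

(** * Reduction of monomials modulo integral equations *)
Section FiniteAlgebra.
Variables (k : fieldType) (T : Type) (X : set T) (N M d : nat).
Variable y : 'I_N + 'I_M -> T -> k.

Definition is_left (j : 'I_N + 'I_M) := if j is inl _ then true else false.

Definition reduced (w : seq ('I_N + 'I_M)) :=
  [forall b : 'I_N, count_mem (inl b) w < d]%N.

Hypothesis integral : forall b : 'I_N,
  spanned X y (fun u => (size u <= d) && (count is_left u < d))%N
    (fun v => y (inl b) v ^+ d).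

(** Replacing a factor t_b^d by its expression does not increase the length of
a word and strictly decreases its number of left letters, so this rewriting ends
with reduced words. *)
Lemma spanned_reduced (w : seq ('I_N + 'I_M)) :
  spanned X y (fun u => (size u <= size w)%N && reduced u) (monomial y w).
Proof.
have [n] := ssrnat.ubnP (count is_left w); elim: n w => // n IHn w /ltnSE le_wn.
have [red_w|] := boolP (reduced w).
  by apply: spanned_monomial; rewrite leqnn.
move=> /forallPn[b]; rewrite -leqNgt => le_d.
set c := count_mem (inl b) w in le_d.
pose w' := nseq (c - d) (inl b : 'I_N + 'I_M) ++ [seq j <- w | j != inl b].
(* A word with too many letters b is, up to order, b^d followed by w'. *)
have ww' : perm_eq w (nseq d (inl b : 'I_N + 'I_M) ++ w').
  rewrite /w' catA -nseqD subnKC //.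
  rewrite -(perm_filterC (pred1 (inl b : 'I_N + 'I_M)) w).
  rewrite (_ : [seq x <- w | _] = nseq c (inl b)) //.
  by rewrite /c -size_filter; apply/all_pred1P/filter_all.
have Ew : forall v, X v -> monomial y w v = y (inl b) v ^+ d * monomial y w' v.
  move=> v _; rewrite /monomial (perm_big _ ww') big_cat /= big_nseq.
  by rewrite -Monoid.iteropE.
apply: eq_spanned Ew _.
have sz_w : size w = (d + size w')%N by rewrite (perm_size ww') size_cat size_nseq.
have ct_w : count is_left w = (d + count is_left w')%N.
  by rewrite (permP ww') count_cat count_nseq mul1n.
apply: spanned_trans
  (spannedM (P'' := fun u => (size u <= size w) && (count is_left u < n))%N _
    (integral b) (spanned_monomial X y (P := pred1 w') (eqxx _))) _.
  move=> u _ /andP[sz_u ct_u] /eqP ->.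
  rewrite size_cat count_cat sz_w leq_add2r sz_u /=.
  by apply: leq_trans le_wn; rewrite ct_w ltn_add2r.
move=> u /andP[sz_u /IHn]; apply: sub_spanned => z /= /andP[sz_z ->].
by rewrite andbT; apply: leq_trans sz_z sz_u.
Qed.

End FiniteAlgebra.

(** * Counting independent functions *)
Definition independent_on (k : fieldType) (T : Type) (X : set T) (G : finType)
    (g : G -> T -> k) : Prop :=
  forall a : G -> k,
    (forall v, X v -> \sum_j a j * g j v = 0) -> forall j, a j = 0.

Lemma card_independent_on (k : fieldType) (T : Type) (X : set T)
    (G A : finType) (g : G -> T -> k) (h : A -> T -> k) :
  independent_on X g ->
  (forall j, exists c : A -> k, forall v, X v -> g j v = \sum_i c i * h i v) ->
  (#|G| <= #|A|)%N.
Proof.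
move=> indep /choice[c gE]; rewrite leqNgt; apply/negP => lt_AG.
pose C := \matrix_(j < #|G|, i < #|A|) c (enum_val j) (enum_val i).
have : kermx C != 0.
  rewrite kermx_eq0 /row_free neq_ltn (leq_ltn_trans _ lt_AG) //.
  exact: rank_leq_col.
case/rowV0Pn => u /sub_kermxP uC /eqP[]; apply/rowP => i; rewrite mxE.
rewrite -(enum_valK i); move: (enum_val i).
apply: indep => v Xv.
under eq_bigr do rewrite gE // big_distrr /=.
rewrite exchange_big big1 //= => a _.
under eq_bigr do rewrite mulrA.
rewrite -big_distrl /= (reindex _ (onW_bij _ (enum_val_bij G))) /=.
have /rowP/(_ (enum_rank a)) := uC; rewrite !mxE => uCa.
rewrite [X in X * _](_ : _ = 0) ?mul0r // -[RHS]uCa.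
by apply: eq_bigr => j _; rewrite !mxE enum_valK enum_rankK.
Qed.

Lemma monomialE (k : fieldType) (T : Type) (J : finType) (y : J -> T -> k)
    (w : seq J) (v : T) :
  monomial y w v = \prod_j y j v ^+ count_mem j w.
Proof.
elim: w => [|i w IHw] /=; first by rewrite /monomial big_nil big1.
rewrite /monomial big_cons -/(monomial y w v) IHw [in RHS](bigD1 i) //=.
rewrite [in LHS](bigD1 i) //= eqxx exprS -mulrA; congr (_ * (_ * _)).
by apply: eq_bigr => j /negPf ji; rewrite eq_sym ji.
Qed.

(** A reduced word of length at most E has exponents less than d in the N left
letters and at most E in the M right ones. *)
Lemma reduced_spanned_bound (k : fieldType) (T : Type) (X : set T)
    (N M d E : nat) (y : 'I_N + 'I_M -> T -> k) (G : finType)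
    (g : G -> T -> k) :
  independent_on X g ->
  (forall j, spanned X y (fun u => (size u <= E)%N && reduced d u) (g j)) ->
  (#|G| <= d ^ N * E.+1 ^ M)%N.
Proof.
move=> indep spang.
pose h (a : {ffun 'I_N -> 'I_d} * {ffun 'I_M -> 'I_E.+1}) v :=
  (\prod_b y (inl b) v ^+ a.1 b) * \prod_c y (inr c) v ^+ a.2 c.
suff hE j : exists c, forall v, X v -> g j v = \sum_a c a * h a v.
  by have := card_independent_on indep hE; rewrite card_prod !card_ffun !card_ord.
have [l] := spang j; elim: l (g j) => [|x l IHl] f.
  move=> _ fE; exists (fun=> 0) => v Xv; rewrite fE // big_nil.
  by rewrite big1 // => a _; rewrite mul0r.
move=> /= /andP[/andP[sz_x /forallP red_x] Pl] fE.
have [c cE] := IHl _ Pl (fun v _ => erefl _).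
pose a0 : {ffun 'I_N -> 'I_d} * {ffun 'I_M -> 'I_E.+1} :=
  ([ffun b => Ordinal (red_x b)],
   [ffun b => inord (count_mem (inr b) x.2)]).
exists (fun a => c a + x.1 *+ (a == a0)) => v Xv.
under eq_bigr do rewrite mulrDl.
rewrite big_split /= -cE // fE // big_cons addrC; congr (_ + _).
rewrite (bigD1 a0) //= eqxx mulr1n big1 ?addr0; last first.
  by move=> a /negPf ->; rewrite mulr0n mul0r.
congr (_ * _); rewrite monomialE big_sumType /h /=.
congr (_ * _); apply: eq_bigr => b _; rewrite !ffunE //.
by rewrite inordK // ltnS (leq_trans _ sz_x) ?count_size.
Qed.

(** If D > M, the left side grows at least as (e + 1)^(M + 1), hence faster than
the right side. *)
Lemma chain_length_bound (d N M D h : nat) : (0 < d)%N ->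
  (forall e : nat, (e.+1 ^ D <= d ^ N * (h * e).+1 ^ M)%N) -> (D <= M)%N.
Proof.
move=> d0 growth; rewrite leqNgt; apply/negP => lt_MD.
(* The right side is at most e (e + 1)^M for this e, since
   h e + 1 <= (h + 1) (e + 1). *)
pose e := (d ^ N * h.+1 ^ M)%N.
have : (e.+1 ^ M.+1 <= e * e.+1 ^ M)%N.
  apply: leq_trans (leq_trans (growth e) _); first by rewrite leq_pexp2l.
  rewrite -mulnA leq_mul2l -expnMn; apply/orP; right.
  by have [->//|M0] := posnP M; rewrite leq_exp2r //; nia.
by rewrite expnS leq_pmul2r ?expn_gt0 // ltnn.
Qed.

(** * Chains of irreducible closed sets *)
Section Chains.
Variables (k : closedFieldType) (V : vectType k).

Definition poly_fun (p : mpoly.mpoly (\dim {:V}) k) (v : V) : k :=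
  mpoly.meval (coord (vbasis {:V}) ^~ v) p.

Lemma poly_funM p q v : poly_fun (p * q) v = poly_fun p v * poly_fun q v.
Proof. exact: rmorphM. Qed.

Lemma poly_funX p e v : poly_fun (p ^+ e) v = poly_fun p v ^+ e.
Proof. exact: rmorphXn. Qed.

Lemma irreducible_mul_eq0 (Z : set V) p q :
  irreducible_algebraic_set Z ->
  (forall v, Z v -> poly_fun (p * q) v = 0) ->
  (forall v, Z v -> poly_fun p v = 0) \/ (forall v, Z v -> poly_fun q v = 0).
Proof.
move=> [_ _ irrZ] pq0.
pose zeros r := [set v | poly_fun r v = 0].
have closed r : algebraic_set (zeros r).
  by exists [set r]; apply/seteqP; split => v /= rv; [move=> p' -> | exact: rv].
have [|Zp|Zq] := irrZ _ _ (closed p) (closed q).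
- move=> v /pq0; rewrite poly_funM => /eqP.
  by rewrite mulf_eq0 => /orP[] /eqP; [left|right].
- by left=> v /Zp.
- by right=> v /Zq.
Qed.

Lemma irreducible_exp_eq0 (Z : set V) p e :
  irreducible_algebraic_set Z ->
  (forall v, Z v -> poly_fun (p ^+ e) v = 0) ->
  forall v, Z v -> poly_fun p v = 0.
Proof.
move=> irrZ pe0 v /pe0; rewrite poly_funX => /eqP.
by rewrite expf_eq0 => /andP[_ /eqP].
Qed.

(** If f vanishes on Z but not on the larger irreducible set Z', the powers of f
are independent over functions that are independent on Z.  In a relation on Z',
let i be the least exponent of f with a nonzero coefficient; the relation is
f^i q, so q vanishes on Z', and on Z only the terms of exponent i remain in q. *)
Lemma independent_on_powers (Z Z' : set V) (f : mpoly.mpoly (\dim {:V}) k) e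
    (G : finType) (p : G -> mpoly.mpoly (\dim {:V}) k) :
  irreducible_algebraic_set Z' -> Z `<=` Z' ->
  (forall v, Z v -> poly_fun f v = 0) ->
  ~ (forall v, Z' v -> poly_fun f v = 0) ->
  independent_on Z (fun j => poly_fun (p j)) ->
  independent_on Z' (fun x : G * 'I_e => poly_fun (p x.1 * f ^+ x.2)).
Proof.
(* Strong induction on the exponent i. *)
move=> irrZ' ZZ' fZ fZ' indep a a0 [j i] /=.
have [m] := ssrnat.ubnP i; elim: m i j => // m IHm i j /ltnSE le_im.
have low (l : 'I_e) j' : (l < i)%N -> a (j', l) = 0.
  by move=> li; apply: IHm; apply: leq_trans li le_im.
(* The relation a0 divided by f^i. *)
pose q := \sum_(x : G * 'I_e | (i <= x.2)%N)
  mpoly.mpolyC _ (a x) * (p x.1 * f ^+ (x.2 - i)).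
have qE v : poly_fun q v =
    \sum_(x : G * 'I_e | (i <= x.2)%N) a x * poly_fun (p x.1 * f ^+ (x.2 - i)) v.
  rewrite /poly_fun rmorph_sum; apply: eq_bigr => x _.
  by rewrite rmorphM /= mpoly.mevalC.
have fq v : Z' v -> poly_fun (f ^+ i * q) v = 0.
  move=> Z'v; rewrite -(a0 v Z'v) poly_funM qE.
  rewrite big_distrr [RHS](bigID (fun x : G * 'I_e => (i <= x.2)%N)) /=.
  rewrite [X in _ = _ + X]big1 ?addr0 => [|[j' l] /=]; last first.
    by rewrite -ltnNge => li; rewrite low // mul0r.
  apply: eq_bigr => x ix.
  rewrite mulrCA -poly_funM; congr (_ * poly_fun _ v).
  by rewrite mulrCA -exprD subnKC.
have [fi|qZ'] := irreducible_mul_eq0 irrZ' fq.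
  by case: fZ'; apply: irreducible_exp_eq0 fi.
apply: (indep (fun j => a (j, i)) _ j) => v Zv.
rewrite -[RHS](qZ' v (ZZ' _ Zv)) qE.
rewrite (bigID (fun x : G * 'I_e => x.2 == i)) /=.
rewrite [X in _ = _ + X]big1 ?addr0 => [|x /andP[ix xi]]; last first.
  rewrite poly_funM poly_funX fZ //.
  rewrite expr0n subn_eq0 leqNgt ltn_neqAle ix eq_sym.
  by rewrite (inj_eq val_inj) xi /= !mulr0.
rewrite (reindex_onto (fun j => (j, i)) (fun x => x.1)) /=; last first.
  by move=> [j' l] /andP[_ /= /eqP ->].
apply: eq_big => [j'|j' _]; first by rewrite leqnn !eqxx.
by rewrite subnn expr0 mulr1.
Qed.

Variables (J : eqType) (X : set V) (y : J -> V -> k).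
Hypothesis affine_coord : forall i,
  spanned X y (fun u => size u <= 1)%N (coord (vbasis {:V}) i).

Lemma poly_fun_spanned p : exists h,
  spanned X y (fun u => size u <= h)%N (poly_fun p).
Proof.
exists (\max_(m <- mpoly.msupp p) \sum_(i < \dim {:V}) 1 * m i)%N.
apply: (@eq_spanned _ _ _ _ _ _ _
  (fun v => \sum_(m <- mpoly.msupp p | m \in mpoly.msupp p)
     mpoly.mcoeff m p * \prod_i coord (vbasis {:V}) i v ^+ m i)).
  by move=> v _; rewrite /poly_fun mpoly.mevalE big_seq.
apply: spanned_sum => m p_m; apply: spannedZ.
apply: sub_spanned (spanned_prod _ (fun i => spannedX (m i) (affine_coord i))).
move=> u /leq_trans; apply; exact: leq_bigmax_seq.
Qed.

(** The witnesses are the products f_1^(a_1) ... f_D^(a_D) with a_i <= e, where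
f_i vanishes on Z (i-1) and not on Z i; the constant h is the sum of degree bounds
for the f_i and hence is the same for all e. *)
Lemma chain_independent D Z : irreducible_chain X D Z ->
  exists h, forall e, exists (G : finType) (p : G -> mpoly.mpoly (\dim {:V}) k),
    [/\ #|G| = (e.+1 ^ D)%N, independent_on (Z D) (fun j => poly_fun (p j)) &
      forall j, spanned X y (fun u => size u <= h * e)%N (poly_fun (p j))].
Proof.
elim: D => [|D IHD] [irrZ ltZ].
  exists 0%N => e; exists unit, (fun=> 1); split => [|a a0 []|_].
  - by rewrite card_unit.
  - have [[_ [v Zv] _] _] := irrZ 0%N isT.
    have := a0 v Zv; rewrite (bigD1 tt) // big1 => [|[]//] /=.
    by rewrite addr0 /poly_fun rmorph1 mulr1.
  - by apply: eq_spanned (spanned1 X y) => v _; rewrite /poly_fun rmorph1.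
have [|h hP] := IHD; first by split=> i iD; [apply: irrZ|apply: ltZ]; exact: ltnW.
have [[algD _ _] _] := irrZ D (leqnSn D).
have [irrS _] := irrZ D.+1 (leqnn _).
have [subZ nsubZ] := ltZ D (leqnn _).
have [f fZ fZ'] : exists2 f, (forall v, Z D v -> poly_fun f v = 0) &
    ~ (forall v, Z D.+1 v -> poly_fun f v = 0).
  case: algD => S ZDE; apply: contrapT => nof; apply: nsubZ => v Zv.
  rewrite ZDE /= => p Sp; apply: contrapT => pv; apply: nof; exists p.
    by move=> w; rewrite ZDE => /(_ p Sp).
  by move=> /(_ v Zv).
have [hf hfP] := poly_fun_spanned f.
exists (h + hf)%N => e; have [G [p [cardG indep spanp]]] := hP e.
exists (G * 'I_e.+1)%type, (fun x : G * 'I_e.+1 => p x.1 * f ^+ x.2); split.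
- by rewrite card_prod card_ord cardG expnSr.
- exact: independent_on_powers indep.
move=> [j i]; rewrite mulnDl.
apply: eq_spanned (spannedM _ (spanp j) (spannedX i hfP)) => [v _|u w su sw] /=.
  by rewrite poly_funM poly_funX.
rewrite size_cat leq_add // (leq_trans sw) // leq_mul2l -ltnS ltn_ord orbT //.
Qed.
End Chains.

(** When N of the N + M linear coordinates are integral over the others on X,
with equations of degree d, chains in X are no longer than in an affine space of
dimension M: a chain of length D forces D independent directions of polynomial
growth, and the coordinate ring of X has only M. *)
Lemma irreducible_chain_length (k : closedFieldType) (V : vectType k)
    (X : set V) (N M d : nat) (y : 'I_N + 'I_M -> V -> k)
    (f : 'I_N + 'I_M -> V) (D : nat) (Z : nat -> set V) :
  (0 < d)%N ->
  (forall v, v = \sum_j y j v *: f j) ->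
  (forall b : 'I_N,
     spanned X y (fun u => (size u <= d) && (count (@is_left N M) u < d))%N
       (fun v => y (inl b) v ^+ d)) ->
  irreducible_chain X D Z -> (D <= M)%N.
Proof.
move=> d0 yE integral chainZ.
have affine_coord i :
    spanned X y (fun u => size u <= 1)%N (coord (vbasis {:V}) i).
  apply: (@eq_spanned _ _ _ _ _ _ _
    (fun v => \sum_j coord (vbasis {:V}) i (f j) * monomial y [:: j] v)).
    move=> v _; rewrite {1}(yE v) linear_sum; apply: eq_bigr => j _.
    by rewrite linearZ /monomial big_seq1 mulrC.
  by apply: spanned_sum => j _; apply: spannedZ; apply: spanned_monomial.
have [h hP] := chain_independent affine_coord chainZ.
apply: (chain_length_bound (d := d) (N := N) (h := h)) => // e.
have [G [p [<- indep spanp]]] := hP e.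
apply: (reduced_spanned_bound (X := X) (y := y) (g := fun j => poly_fun (p j))).
  move=> a a0; apply: indep => v Zv; apply: a0.
  by have [_ ZX] := chainZ.1 D (leqnn D); exact: ZX.
move=> j; apply: spanned_trans (spanp j) _ => w sz_w.
apply: sub_spanned (spanned_reduced integral w) => u /andP[sz_u ->].
by rewrite (leq_trans sz_u).
Qed.

Lemma extend_to_coordinates (K : fieldType) (V : vectType K) (N : nat)
    (E : 'I_N -> V) :
  (forall t : 'I_N -> K, \sum_b t b *: E b = 0 -> forall b, t b = 0) ->
  exists (M : nat) (y : 'I_N + 'I_M -> V -> K) (f : 'I_N + 'I_M -> V),
    [/\ (N + M)%N = \dim {:V}, (forall b, f (inl b) = E b) &
        forall v, v = \sum_j y j v *: f j].
Proof.
move=> freeE.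
have nthB (b : 'I_N) : (mktuple E)`_b = E b by rewrite -tnth_nth tnth_mktuple.
have freeB : free (mktuple E).
  apply/freeP => t t0; apply: freeE; rewrite -[RHS]t0.
  by apply: eq_bigr => b _; rewrite nthB.
pose U := <<mktuple E>>%VS.
have dimU : \dim U = N by rewrite (eqnP freeB) size_tuple.
exists (\dim U^C).
exists (fun j v => match j with
  | inl b => coord (mktuple E) b (projv U v)
  | inr c => coord (vbasis U^C) c (v - projv U v) end).
exists (fun j : 'I_N + 'I__ => match j with
  | inl b => E b
  | inr c => (vbasis U^C)`_c end).
split=> // [|v]; first by rewrite dimv_compl dimU subnKC // -dimU dimvS ?subvf.
rewrite big_sumType /= -{1}[v](subrKC (projv U v)).
rewrite {1}(coord_span (memv_proj U v)) {1}(coord_vbasis (memv_projC U v)).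
by congr (_ + _); apply: eq_bigr => b _; rewrite nthB.
Qed.

(** * The weighted paths *)
Section Matrices.
Variables (k : fieldType) (n s : nat).
Implicit Types (r : {ffun 'I_n -> 'M[k]_s}) (u : seq 'I_n).

Definition word_eval r u : 'M[k]_s := \prod_(i <- u) r i.

Lemma word_eval_nil r p q : word_eval r [::] p q = (p == q)%:R.
Proof. by rewrite /word_eval big_nil [1]/(1%:M) mxE. Qed.

Lemma word_eval_cons r i u p q :
  word_eval r (i :: u) p q = \sum_l r i p l * word_eval r u l q.
Proof. by rewrite /word_eval big_cons [_ * _]/(_ *m _) mxE. Qed.

Section Path.
Variables (w : seq 'I_n) (N : nat).
Let d := size w.

(** Block b consists of the arrows p -> p + 1 with b d <= p < (b + 1) d, and the
arrow leaving p is labelled by the letter of w at position p modulo d.  Successive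
blocks share a vertex. *)
Definition path_direction (b : 'I_N) : {ffun 'I_n -> 'M[k]_s} :=
  [ffun i => \matrix_(p, q)
    [&& q == p.+1 :> nat, (p %/ d == b)%N & i == nth i w (p %% d)]%:R].

Definition path_point (t : 'I_N -> k) := \sum_b t b *: path_direction b.

Lemma path_point_entry t i (p q : 'I_s) (b : 'I_N) a :
  (a < d)%N -> p = (b * d + a)%N :> nat ->
  path_point t i p q = t b * ((q == p.+1 :> nat) && (i == nth i w a))%:R.
Proof.
move=> lt_ad pE; rewrite /path_point sum_ffunE summxE (bigD1 b) //=.
have d0 : (0 < d)%N by apply: leq_ltn_trans lt_ad.
have pd : (p %/ d)%N = b by rewrite pE divnMDl // divn_small // addn0.
rewrite big1 ?addr0 => [|b' bb']; rewrite !ffunE !mxE pd.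
  by rewrite eqxx pE modnMDl modn_small.
move: bb'; rewrite eq_sym -(inj_eq val_inj) /= => /negPf ->.
by rewrite andbF mulr0.
Qed.

(** Evaluating a word u follows a path of length |u|, and the path from position
a of block b to its end spells the last d - a letters of w.  The position a
varies for the sake of the induction on u. *)
Lemma word_eval_path_point t (b : 'I_N) u a (p q : 'I_s) :
  (a + size u = d)%N -> p = (b * d + a)%N :> nat -> q = (b * d + d)%N :> nat ->
  word_eval (path_point t) u p q = t b ^+ size u * (u == drop a w)%:R.
Proof.
elim: u a p => [|i u IHu] a p /= aud pE qE.
  rewrite word_eval_nil -(inj_eq val_inj) /= pE qE -aud addn0 eqxx.
  by rewrite drop_oversize ?mulr1 // -/d -aud addn0.
have lt_ad : (a < d)%N by rewrite -aud addnS ltnS leq_addr.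
have lt_ps : (p.+1 < s)%N.
  by apply: leq_ltn_trans (ltn_ord q); rewrite qE pE ltn_add2l.
rewrite word_eval_cons (bigD1 (Ordinal lt_ps)) //= big1 ?addr0 => [|l lp].
  rewrite (path_point_entry _ _ _ lt_ad pE) eqxx /=.
  rewrite (IHu a.+1) ?addSnnS //; last by rewrite /= pE addnS.
  rewrite (drop_nth i lt_ad) eqseq_cons exprS -!mulrA.
  by congr (_ * _); rewrite mulrCA -natrM mulnb.
rewrite (path_point_entry _ _ _ lt_ad pE).
by rewrite -(inj_eq val_inj) /= in lp; rewrite (negPf lp) mulr0 mul0r.
Qed.

(** The evaluation of w at the point t has the entry t_b^d, from the start to the
end of block b, and vanishes at the point 0 as w is not empty. *)
Lemma path_directions_free t :
  (0 < d)%N -> (N * d < s)%N -> path_point t = 0 -> forall b, t b = 0.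
Proof.
move=> d0 lt_s t0 b.
have lt_q : (b * d + d < s)%N.
  by apply: leq_ltn_trans lt_s; rewrite addnC -mulSn leq_mul2r ltn_ord orbT.
have lt_p : (b * d + 0 < s)%N by apply: leq_ltn_trans lt_q; rewrite leq_add2l.
have := word_eval_path_point t (b := b) (u := w) (a := 0)
  (p := Ordinal lt_p) (q := Ordinal lt_q) erefl erefl erefl.
rewrite drop0 eqxx mulr1 t0 => /eqP.
have [i [u wE]] : exists i u, w = i :: u.
  by move: d0; rewrite /d; case: (w) => // i u; exists i, u.
rewrite [X in word_eval _ X]wE word_eval_cons big1 => [|l _]; last first.
  by rewrite ffunE mxE mul0r.
by rewrite eq_sym expf_eq0 => /andP[_ /eqP].
Qed.

End Path.
End Matrices.

(** * The leading part of a matrix word *)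
Section LeadingPart.
Variables (k : fieldType) (n s N M : nat).
Let V := {ffun 'I_n -> 'M[k]_s}.
Variables (X : set V) (y : 'I_N + 'I_M -> V -> k) (f : 'I_N + 'I_M -> V).
Hypothesis yE : forall v, v = \sum_j y j v *: f j.
Implicit Types (u : seq 'I_n) (p q : 'I_s) (i : 'I_n).

Definition left_part (v : V) : V := \sum_b y (inl b) v *: f (inl b).

Lemma entry_spanned i p q :
  spanned X y (fun w => size w <= 1)%N (fun v => v i p q).
Proof.
apply: (@eq_spanned _ _ _ _ _ _ _
  (fun v => \sum_j (f j) i p q * monomial y [:: j] v)).
  move=> v _; rewrite {1}(yE v) sum_ffunE summxE; apply: eq_bigr => j _.
  by rewrite ffunE mxE /monomial big_seq1 mulrC.
by apply: spanned_sum => j _; apply: spannedZ; apply: spanned_monomial.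
Qed.

Lemma left_part_entry_spanned i p q :
  spanned X y (fun w => size w <= 1)%N (fun v => left_part v i p q).
Proof.
apply: (@eq_spanned _ _ _ _ _ _ _
  (fun v => \sum_b (f (inl b)) i p q * monomial y [:: inl b] v)).
  move=> v _; rewrite sum_ffunE summxE; apply: eq_bigr => j _.
  by rewrite ffunE mxE /monomial big_seq1 mulrC.
by apply: spanned_sum => j _; apply: spannedZ; apply: spanned_monomial.
Qed.

Lemma right_part_entry_spanned i p q :
  spanned X y (fun w => (size w <= 1) && (count (@is_left N M) w < 1))%N
    (fun v => v i p q - left_part v i p q).
Proof.
apply: (@eq_spanned _ _ _ _ _ _ _
  (fun v => \sum_c (f (inr c)) i p q * monomial y [:: inr c] v)).
  move=> v _; rewrite {1}(yE v) big_sumType /= -/(left_part v).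
  rewrite ffunE mxE addrAC subrr add0r.
  rewrite sum_ffunE summxE; apply: eq_bigr => j _.
  by rewrite ffunE mxE /monomial big_seq1 mulrC.
by apply: spanned_sum => j _; apply: spannedZ; apply: spanned_monomial.
Qed.

Lemma word_eval_spanned (r : V -> V) u p q :
  (forall i p q, spanned X y (fun w => size w <= 1)%N (fun v => r v i p q)) ->
  spanned X y (fun w => size w <= size u)%N (fun v => word_eval (r v) u p q).
Proof.
move=> spr; elim: u p => [|i u IHu] p /=.
  apply: eq_spanned (spannedZ (p == q)%:R (spanned1 X y)) => v _.
  by rewrite word_eval_nil mulr1.
apply: eq_spanned => [v _|]; first exact: word_eval_cons.
apply: spanned_sum => l _; apply: spannedM (spr i p l) (IHu l) => w w' sw sw'.
by rewrite size_cat (leq_add sw sw').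
Qed.

(** Replacing v by its left part changes only terms that involve a right
coordinate; these have at most |u| factors in all, so less than |u| left ones. *)
Lemma word_eval_left_part u p q :
  spanned X y (fun w => (size w <= size u) && (count (@is_left N M) w < size u))%N
    (fun v => word_eval v u p q - word_eval (left_part v) u p q).
Proof.
elim: u p => [|i u IHu] p /=.
  apply: eq_spanned (spanned0 X y _) => v _.
  by rewrite !word_eval_nil subrr.
apply: (@eq_spanned _ _ _ _ _ _ _ (fun v : V => \sum_l
   (v i p l * (word_eval v u l q - word_eval (left_part v) u l q) +
   (v i p l - left_part v i p l) * word_eval (left_part v) u l q))).
  move=> v _; rewrite !word_eval_cons -sumrB; apply: eq_bigr => l _.
  by rewrite mulrBr mulrBl subrKA.
apply: spanned_sum => l _; apply: spannedD.
  apply: spannedM (entry_spanned i p l) (IHu l) => w w' sw /andP[sw' cw'].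
  rewrite size_cat count_cat (leq_add sw sw') /= -addnS.
  by rewrite -(add1n (size u)) leq_add // (leq_trans (count_size _ _)).
apply: spannedM (right_part_entry_spanned i p l)
  (word_eval_spanned u l q left_part_entry_spanned) => w w' /andP[sw cw] sw'.
rewrite size_cat count_cat (leq_add sw sw') /= -addSn.
by rewrite -(add1n (size u)) leq_add // (leq_trans (count_size _ _)).
Qed.

End LeadingPart.

(** * The zero locus *)
Section ZeroLocusChains.
Variables (k : closedFieldType) (n s N : nat) (Q : free_algebra k n).
Variable w0 : monalg.fmonom 'I_n.
Let deg (w : monalg.fmonom 'I_n) := size (monalg.fmonom_val w).
Let d := deg w0.
Hypothesis Qw0 : monalg.mcoeff w0 Q != 0.
Hypothesis w0_max : forall w, w \in monalg.msupp Q -> (deg w <= d)%N.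
Hypotheses (d_gt0 : (0 < d)%N) (lt_s : (N * d < s)%N).

(** The entry of Q v from the start to the end of block b is c t_b^d plus terms of
degree at most d and of degree less than d in the left coordinates: the words
other than w0 of length d contribute 0 to the pure left part, and shorter words
have too few factors. *)
Lemma zero_locus_integral (M : nat)
    (y : 'I_N + 'I_M -> {ffun 'I_n -> 'M[k]_s} -> k)
    (f : 'I_N + 'I_M -> {ffun 'I_n -> 'M[k]_s}) (b : 'I_N) :
  (forall v, v = \sum_j y j v *: f j) ->
  (forall b, f (inl b) = path_direction k s (monalg.fmonom_val w0) b) ->
  spanned (@zero_locus k n s Q) y
    (fun u => (size u <= d) && (count (@is_left N M) u < d))%N
    (fun v => y (inl b) v ^+ d).
Proof.
move=> yE fE.
have lt_q : (b * d + d < s)%N.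
  by apply: leq_ltn_trans lt_s; rewrite addnC -mulSn leq_mul2r ltn_ord orbT.
have lt_p : (b * d + 0 < s)%N by apply: leq_ltn_trans lt_q; rewrite leq_add2l.
pose p := Ordinal lt_p; pose q := Ordinal lt_q.
have leftE v : left_part y f v =
    path_point s (monalg.fmonom_val w0) (fun b => y (inl b) v).
  by apply: eq_bigr => b' _; rewrite fE.
(* The contribution of w to that entry, without its pure left part of degree d. *)
pose h w v := word_eval v (monalg.fmonom_val w) p q -
  (if deg w == d then word_eval (left_part y f v) (monalg.fmonom_val w) p q
   else 0).
apply: (@eq_spanned _ _ _ _ _ _ _ (fun v => - (monalg.mcoeff w0 Q)^-1 *
  \sum_(w <- monalg.msupp Q | w \in monalg.msupp Q)
     monalg.mcoeff w Q * h w v)).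
  move=> v; rewrite /zero_locus /= /free_eval => /matrixP/(_ p q).
  rewrite summxE mxE -big_seq => v0.
  under eq_bigr do rewrite mulrBr.
  rewrite sumrB (_ : \sum_(w <- _) _ = 0) ?sub0r; last first.
    by rewrite -[RHS]v0; apply: eq_bigr => w _; rewrite mxE.
  rewrite mulrNN (bigD1_seq w0) -?monalg.mcoeff_neq0 //=; last exact: fset_uniq.
  rewrite leftE eqxx.
  rewrite (word_eval_path_point _ (b := b) (a := 0)) // drop0 eqxx mulr1.
  rewrite big1 ?addr0 ?mulKf // => w ww0.
  case: ifP => [/eqP dw|_]; last by rewrite mulr0.
  rewrite (word_eval_path_point _ (b := b) (a := 0)) // drop0.
  rewrite (_ : _ == _ = false) ?mulr0 //.
  by apply: contraNF ww0 => /eqP wE; apply/eqP/val_inj.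
apply: spannedZ; apply: spanned_sum => w /w0_max le_wd; apply: spannedZ.
rewrite /h; case: eqP => [dw|/eqP ne_wd].
  by rewrite -dw; exact: word_eval_left_part.
apply: eq_spanned => [v _|]; first by rewrite subr0.
have := word_eval_spanned (r := id) (monalg.fmonom_val w) p q
  (entry_spanned (@zero_locus k n s Q) yE).
apply: sub_spanned => u /= le_uw; rewrite (leq_trans le_uw) //=.
apply: leq_ltn_trans (count_size _ _) (leq_ltn_trans le_uw _).
by rewrite ltn_neqAle ne_wd.
Qed.

Lemma zero_locus_chain_length D Z :
  irreducible_chain (@zero_locus k n s Q) D Z ->
  (N + D <= \dim {: {ffun 'I_n -> 'M[k]_s}})%N.
Proof.
move=> chainZ.
have free_dir (t : 'I_N -> k) :
    \sum_b t b *: path_direction k s (monalg.fmonom_val w0) b = 0 ->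
    forall b, t b = 0.
  exact: path_directions_free d_gt0 lt_s.
have [M [y [f [<- fE yE]]]] := extend_to_coordinates free_dir.
rewrite leq_add2l; apply: (irreducible_chain_length d_gt0 yE _ chainZ) => b.
exact: (zero_locus_integral b yE fE).
Qed.

End ZeroLocusChains.

Lemma zero_locus_const (k : closedFieldType) (n s : nat)
    (Q : free_algebra k n) (w0 : monalg.fmonom 'I_n) :
  monalg.mcoeff w0 Q != 0 -> (0 < s)%N ->
  (forall w, w \in monalg.msupp Q -> monalg.fmonom_val w = [::]) ->
  @zero_locus k n s Q = set0.
Proof.
case: s => // s Qw0 _ Qconst; rewrite -subset0 => v.
have Qw0' : w0 \in monalg.msupp Q by rewrite -monalg.mcoeff_neq0.
have suppE w : w \in monalg.msupp Q -> w = w0.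
  by move=> /Qconst wE; apply: val_inj; rewrite /= wE Qconst.
rewrite /zero_locus /= /free_eval (bigD1_seq w0) ?fset_uniq //=.
rewrite [X in _ + X]big_seq_cond.
rewrite [X in _ + X]big1 => [|w /andP[/suppE ->]]; last by rewrite eqxx.
rewrite addr0 Qconst // big_nil => /matrixP/(_ ord0 ord0) /eqP.
by rewrite !mxE mulr1 (negPf Qw0).
Qed.

Theorem corollary2 (R : realType) (k : closedFieldType) (n : nat)
    (Q : free_algebra k n) (hQ : Q != 0) :
  alg_codim R (@zero_locus k n s Q) @[s --> \oo] --> +oo%E.
Proof.
have [w0 Qw0 w0_max] : exists2 w0 : monalg.fmonom 'I_n, monalg.mcoeff w0 Q != 0 &
    forall w, w \in monalg.msupp Q ->
      (size (monalg.fmonom_val w) <= size (monalg.fmonom_val w0))%N.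
  have [w1 Qw1] : exists w1, w1 \in monalg.msupp Q.
    by apply/fset0Pn; rewrite monalg.msupp_eq0.
  pose has_size m :=
    has (fun w => size (monalg.fmonom_val w) == m) (monalg.msupp Q).
  have ex_size : exists m, has_size m.
    by exists (size (monalg.fmonom_val w1)); apply/hasP; exists w1.
  case: (@ex_maxnP has_size
    (\max_(w <- monalg.msupp Q) size (monalg.fmonom_val w)) ex_size).
    by move=> m /hasP[w Qw /eqP <-]; exact: leq_bigmax_seq.
  move=> m /hasP[w0 Qw0 /eqP w0m] max_m; exists w0.
    by rewrite monalg.mcoeff_neq0.
  by move=> w Qw; rewrite w0m; apply: max_m; apply/hasP; exists w.
apply/cvgeyPge => A.
have [N AN] : exists N : nat, A <= N%:R.
  by exists (Num.trunc A).+1; rewrite ltW // truncnS_gt.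
near=> s.
have [d0|d_gt0] := posnP (size (monalg.fmonom_val w0)).
  rewrite (zero_locus_const Qw0) ?alg_codim_set0 ?leey //.
    by near: s; exact: nbhs_infty_gt.
  by move=> w /w0_max; rewrite d0 leqn0 => /nilP.
have lt_s : (N * size (monalg.fmonom_val w0) < s)%N.
  by near: s; exact: nbhs_infty_gt.
have dimX : (alg_dim R (@zero_locus k n s Q) <=
    ((\dim {: {ffun 'I_n -> 'M[k]_s}})%:R - N%:R)%:E)%E.
  apply: ge_ereal_sup => _ [D [Z chainZ] <-].
  have := zero_locus_chain_length Qw0 w0_max d_gt0 lt_s chainZ.
  by rewrite lee_fin lerBrDl -natrD ler_nat.
rewrite /alg_codim; apply: le_trans (leeB (lexx _) dimX).
by rewrite -EFinB lee_fin opprB addrC subrK.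
Unshelve. all: by end_near.
Qed.
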